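(* Let $n,m\ge 1$ be integers, and let $M_1\in \mathrm{COP}_n$ and $M_2\in \mathrm{COP}_m$ be two copositive matrices. Assume that $M_1\notin \mathcal K_n^{(0)}$ and that there exists $z\in\mathbb R^m$ with $z\ge 0$ (entrywise), $z\ne 0$, such that $z^TM_2z=0$. Then $$\begin{pmatrix} M_1 & 0\\ 0 & M_2\end{pmatrix}\in \mathrm{COP}_{n+m}\setminus \bigcup_{r\in\mathbb N}\mathcal K_{n+m}^{(r)}.$$
   Context: Let $\mathcal S^n$ be the space of real symmetric $n\times n$ matrices and $\mathbb N=\{0,1,2,\dots\}$. For $x\in\mathbb R^n$ put $x^{\circ 2}=(x_1^2,\dots,x_n^2)$. The copositive cone is $\mathrm{COP}_n=\{M\in\mathcal S^n: (x^{\circ 2})^TMx^{\circ 2}\ge 0 \text{ for all } x\in\mathbb R^n\}$. Let $\Sigma$ denote the set of finite sums of squares of real polynomials (in the relevant variables). For $r\in\mathbb N$, $\mathcal K_n^{(r)}=\{M\in\mathcal S^n: (\sum_{i=1}^n x_i^2)^r\,(x^{\circ 2})^TMx^{\circ 2}\in\Sigma\}$. *)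

(* Defs.v *)
From mathcomp Require Import all_boot all_order all_algebra.
From mathcomp Require Import classical_sets reals.
From mathcomp Require Import mpoly.
Set Implicit Arguments.
Unset Strict Implicit.
Unset Printing Implicit Defensive.
Import GRing.Theory Num.Theory.
Local Open Scope classical_set_scope.
Local Open Scope ring_scope.

(* [sqmx] and [qform] are stated over an arbitrary commutative ring so that
   they apply both to real vectors and to the vector of indeterminates. *)
Definition sqmx (S : comNzRingType) (n : nat) (x : 'cV[S]_n) : 'cV[S]_n :=
  \col_i (x i 0) ^+ 2.

Definition qform (S : comNzRingType) (n : nat) (A : 'M[S]_n) (x : 'cV[S]_n) : S :=
  (x^T *m A *m x) 0 0.

Definition COP (R : realType) (n : nat) : set 'M[R]_n :=
  [set M | M \is symmetricmx /\ forall x : 'cV[R]_n, 0 <= qform M (sqmx x)].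

Definition SOS (R : realType) (n : nat) : set {mpoly R[n]} :=
  [set p | exists s : seq {mpoly R[n]}, p = \sum_(q <- s) q ^+ 2].

Definition varmx (R : realType) (n : nat) : 'cV[{mpoly R[n]}]_n :=
  \col_i 'X_i.

Definition Kcone (R : realType) (n r : nat) : set 'M[R]_n :=
  [set M | M \is symmetricmx /\
     SOS ((\sum_(i < n) 'X_i ^+ 2) ^+ r *
          qform (map_mx (mpolyC n (R := R)) M) (sqmx (varmx R n)))].

(* Main.v *)
(** If (|x|^2 + |y|^2)^r (P1(x) + P2(y)) is a sum of squares, where P1 and P2
    are the quartic forms of M1 and M2, substitute y_j := t * sqrt(z_j). Then
    P2 vanishes, so (|x|^2 + c t^2)^r P1(x) is a sum of squares q_i(x, t)^2
    with c = sum_j z_j > 0. Top coefficients of squares cannot cancel, so each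
    q_i has degree at most r in t, and comparing coefficients of t^(2r)
    exhibits c^r P1, hence P1, as a sum of squares in x. *)
Require Import Defs.
From mathcomp Require Import all_boot all_order all_algebra.
From mathcomp Require Import classical_sets reals.
From mathcomp Require Import mpoly.
Import Order.TTheory.
Import GRing.Theory Num.Theory.
Local Open Scope classical_set_scope.
Local Open Scope ring_scope.

(** Only the index [a] survives in the convolution: below it the factor from [q] is beyond [b],
    above it the factor from [p] is zero. *)
Lemma coef_mul_top {A : comNzRingType} {p q : {poly A}} {a b : nat} :
  (size p <= a.+1)%N -> (size q <= b.+1)%N ->
  (p * q)`_(a + b) = p`_a * q`_b.
Proof.
move=> sp sq; have ltaab : (a < (a + b).+1)%N by rewrite ltnS leq_addr.
rewrite coefM (bigD1 (Ordinal ltaab)) //= addKn big1 ?addr0 // => -[j ltj] /=.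
rewrite -val_eqE /= => neja; have [ltja|leaj] := ltnP j a.
  by rewrite [q`__]nth_default ?mulr0 // (leq_trans sq) // ltn_subRL ltn_add2r.
rewrite [p`_j]nth_default ?mul0r // (leq_trans sp) //.
by rewrite ltn_neqAle eq_sym neja.
Qed.

Lemma coef_exp_top {A : comNzRingType} {p : {poly A}} {d : nat} (r : nat) :
  (size p <= d.+1)%N ->
  (size (p ^+ r) <= (d * r).+1)%N /\ (p ^+ r)`_(d * r) = p`_d ^+ r.
Proof.
move=> sp; elim: r => [|r [IHs IHc]].
  by rewrite !expr0 muln0 size_poly1 coef1.
rewrite !exprS mulnS; split; last by rewrite coef_mul_top // IHc.
rewrite (leq_trans (size_polyMleq _ _)) //.
have := leq_add sp IHs; rewrite addSn addnS.
by case: (_ + _)%N => //= k; rewrite ltnS.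
Qed.

Lemma coef_sumsq_top {A : comNzRingType} {s : seq {poly A}} {d : nat} :
  (forall q, q \in s -> (size q <= d.+1)%N) ->
  (\sum_(q <- s) q ^+ 2)`_(d + d) = \sum_(q <- s) q`_d ^+ 2.
Proof.
move=> ss; rewrite coef_sum big_seq [RHS]big_seq.
by apply: eq_bigr => q qs; rewrite !expr2 coef_mul_top // ss.
Qed.

(** This is the non-cancellation property needed of the ring of coefficients of the powers of t. *)
Definition formally_real (A : comNzRingType) : Prop :=
  forall s : seq A, \sum_(a <- s) a ^+ 2 = 0 -> forall a, a \in s -> a = 0.

(** Take [s_k] with the largest leading monomial [F k]. The coefficient of the sum at [F k + F k] is
    the sum of the squares of the coefficients at [F k], so all of these vanish in the ordered ring
    [R]. *)
Lemma formally_real_mpoly (R : realDomainType) (n : nat) :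
  formally_real {mpoly R[n]}.
Proof.
move=> s s0 q qs; pose ix := index q s.
have lti : (ix < size s)%N by rewrite index_mem.
pose F (i : 'I_(size s)) := mlead s`_i.
case: (@Order.TotalTheory.arg_maxP _ _ _ (Ordinal lti) xpredT F isT) => k _ kmax.
have coef0 i : (i < size s)%N -> (s`_i)@_(F k) = 0.
  move=> ltis; apply/eqP; rewrite -sqrf_eq0; apply/eqP.
  have := congr1 (mcoeff (F k + F k)%MM) s0; rewrite raddf_sum mcoeff0 /=.
  rewrite (big_nth 0) big_mkord.
  have sqE (j : 'I_(size s)) : (s`_j ^+ 2)@_(F k + F k)%MM = (s`_j)@_(F k) ^+ 2.
    by rewrite !expr2 mleadcMW //; exact: (kmax j isT).
  under eq_bigr do rewrite sqE.
  by move=> S0; apply: (psumr_eq0P _ S0 (i := Ordinal ltis)) => // j _; exact: sqr_ge0.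
(* The leading coefficient of [s_k] is among them. So [s_k] is zero, [F k] is the trivial monomial,
   and by maximality every [q] is a constant, whose value is again a vanishing coefficient. *)
have sk0 : s`_k = 0 by apply/eqP; rewrite -mleadc_eq0 (coef0 k).
have := coef0 ix lti; have := kmax (Ordinal lti) isT.
rewrite /F sk0 mlead0 /= nth_index // => leq0 q0.
apply/eqP; rewrite -mleadc_eq0.
have -> : mlead q = 0%MM by apply/eqP; rewrite -lex0.
by rewrite q0.
Qed.

(** Descent on the excess [d] of the degrees over [r]: while it is positive, the coefficients at
    [r + d] have squares summing to a coefficient of the sum beyond [r + r], which is zero, so each
    of them vanishes. *)
Lemma size_sumsq {A : comNzRingType} {s : seq {poly A}} {r : nat} :
  formally_real A -> (size (\sum_(q <- s) q ^+ 2)%R <= (r + r).+1)%N ->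
  forall q, q \in s -> (size q <= r.+1)%N.
Proof.
move=> Areal sS.
suff H d : (forall q, q \in s -> (size q <= (r + d).+1)%N) ->
    forall q, q \in s -> (size q <= r.+1)%N.
  (* The largest size is a crude excess to start the descent from. *)
  apply: (H (\max_(q <- s) size q)) => q qs.
  rewrite leqW // (leq_trans _ (leq_addl _ _)) //.
  exact: (leq_bigmax_seq q qs).
elim: d => [|d IHd] sd; first by move=> q /sd; rewrite addn0.
apply: IHd => q qs; apply/leq_sizeP => j; rewrite leq_eqVlt => /predU1P[<-|ltj].
  have := coef_sumsq_top sd; rewrite nth_default; last first.
    by rewrite (leq_trans sS) // !addnS !addSn !ltnS leqW // leq_add // leq_addr.
  move=> /esym S0; rewrite -addnS.
  apply: (Areal [seq p`_(r + d.+1) | p : {poly A} <- s]); first by rewrite big_map.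
  exact: (map_f (fun p : {poly A} => p`_(r + d.+1)) qs).
by rewrite nth_default // (leq_trans (sd q qs)) // addnS.
Qed.

Section QuadraticForms.
Context {S : comNzRingType}.

Lemma qform_block {n m : nat} (A : 'M[S]_n) (B : 'M[S]_m) u v :
  qform (block_mx A 0 0 B) (col_mx u v) = qform A u + qform B v.
Proof.
by rewrite /qform tr_col_mx mul_row_block !mulmx0 addr0 add0r mul_row_col mxE.
Qed.

Lemma sqmx_col {n m : nat} (u : 'cV[S]_n) (v : 'cV[S]_m) :
  sqmx (col_mx u v) = col_mx (sqmx u) (sqmx v).
Proof. by apply/colP=> i; rewrite !mxE; case: split => j; rewrite mxE. Qed.

Lemma qformZ {n : nat} (A : 'M[S]_n) a u : qform A (a *: u) = a ^+ 2 * qform A u.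
Proof.
by rewrite /qform [(a *: u)^T]linearZ /= -!scalemxAl -scalemxAr scalerA mxE expr2.
Qed.

Lemma sqmxZ {n : nat} a (u : 'cV[S]_n) : sqmx (a *: u) = a ^+ 2 *: sqmx u.
Proof. by apply/colP=> i; rewrite !mxE exprMn. Qed.

Context {T : comNzRingType} (f : {rmorphism S -> T}).

Lemma rmorph_qform {n : nat} (A : 'M[S]_n) u :
  f (qform A u) = qform (map_mx f A) (map_mx f u).
Proof. by rewrite /qform map_trmx -!map_mxM [in RHS]mxE. Qed.

Lemma map_sqmx {n : nat} (u : 'cV[S]_n) : map_mx f (sqmx u) = sqmx (map_mx f u).
Proof. by apply/colP=> i; rewrite !mxE rmorphXn. Qed.

End QuadraticForms.

Lemma symmetric_block {R : realType} {n m : nat} {A : 'M[R]_n} {B : 'M[R]_m} :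
  A \is symmetricmx -> B \is symmetricmx -> block_mx A 0 0 B \is symmetricmx.
Proof.
rewrite !qualifE /= !expr0 !scale1r !map_mx_id // => /eqP hA /eqP hB.
by rewrite tr_block_mx !trmx0 -hA -hB.
Qed.

Lemma COP_block {R : realType} {n m : nat} {A : 'M[R]_n} {B : 'M[R]_m} :
  COP A -> COP B -> COP (block_mx A 0 0 B).
Proof.
move=> [sA pA] [sB pB]; split; first exact: symmetric_block.
by move=> x; rewrite -[x]vsubmxK sqmx_col qform_block addr_ge0.
Qed.

(** The factor [1/c] is absorbed into the squares as [sqrt(1/c)]. *)
Lemma SOS_scale {R : realType} {n : nat} {c : R} {p : {mpoly R[n]}} :
  0 < c -> SOS (c%:MP * p) -> SOS p.
Proof.
move=> c0 [s sE]; pose a : R := Num.sqrt c^-1.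
exists [seq a%:MP * q | q <- s]; rewrite big_map.
under eq_bigr do rewrite exprMn.
rewrite -mulr_sumr -sE -rmorphXn /= sqr_sqrtr ?invr_ge0 ?ltW // mulrA -rmorphM /=.
by rewrite mulVf ?mul1r // gt_eqF.
Qed.

(** The outer variable plays t. Each [q] has degree at most [r], and the coefficients at [2 * r]
    give [c^r p] as the sum of the squares of the [q_r]. *)
Lemma SOS_top_coef {R : realType} {n r : nat} {c : R} {N p : {mpoly R[n]}}
    {s : seq {poly {mpoly R[n]}}} :
  0 < c ->
  (N%:P + (c%:MP)%:P * 'X^2) ^+ r * p%:P = \sum_(q <- s) q ^+ 2 -> SOS p.
Proof.
move=> c0 sE; set C := (N%:P + _) in sE.
have sC : (size C <= 3)%N.
  rewrite (leq_trans (size_polyD _ _)) // geq_max (leq_trans (size_polyC_leq1 _)) //=.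
  by rewrite mul_polyC (leq_trans (size_scale_leq _ _)) // size_polyXn.
have [sCr cCr] := coef_exp_top r sC.
have sS : (size (\sum_(q <- s) q ^+ 2)%R <= (r + r).+1)%N.
  rewrite -sE mulrC mul_polyC (leq_trans (size_scale_leq _ _)) //.
  by rewrite addnn -mul2n.
have := coef_sumsq_top (size_sumsq (formally_real_mpoly R n) sS).
rewrite -sE coefMC addnn -mul2n cCr coefD coefC coefCM coefXn /= add0r mulr1.
rewrite -rmorphXn /= => top; apply: (@SOS_scale _ _ (c ^+ r)); first exact: exprn_gt0.
by exists [seq q`_r | q : {poly _} <- s]; rewrite top big_map.
Qed.

Theorem theorem3p2 (R : realType) (n m : nat) (hn : (0 < n)%N) (hm : (0 < m)%N)
    (M1 : 'M[R]_n) (M2 : 'M[R]_m)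
    (hM1 : COP M1) (hM2 : COP M2)
    (hK : ~ Kcone 0 M1)
    (hz : exists z : 'cV[R]_m,
        [/\ forall i, 0 <= z i 0, z <> 0 & qform M2 z = 0]) :
  (@COP R (n + m) `\` \bigcup_(r in [set: nat]) @Kcone R (n + m) r)
    (block_mx M1 0 0 M2).
Proof.
split; first exact: COP_block.
move=> [r _ [_ [s sE]]]; case: hz => z [z0 zn0 Mz].
apply: hK; split; first by case: hM1.
rewrite expr0 mul1r; set p := qform _ _.
pose iota : {rmorphism R -> {poly {mpoly R[n]}}} := polyC \o @mpolyC n R.
pose w : 'cV[R]_m := \col_j Num.sqrt (z j 0).
have sqw : sqmx w = z by apply/colP => j; rewrite !mxE sqr_sqrtr.
(* The first [n] variables become coefficients, and the others become multiples of t with factors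
   [sqrt(z_k)]. *)
pose h i := match split i with
  | inl j => ('X_j)%:P : {poly {mpoly R[n]}} | inr k => iota (w k 0) * 'X end.
pose phi : {rmorphism {mpoly R[n + m]} -> {poly {mpoly R[n]}}} := mmap iota h.
pose c := \sum_j z j 0.
have c0 : 0 < c.
  rewrite lt_neqAle sumr_ge0 ?andbT // eq_sym; apply/eqP => /psumr_eq0P zi0.
  by apply: zn0; apply/colP => j; rewrite mxE zi0.
have phiX i : phi 'X_i = h i by rewrite /phi /= mmapX mmap1U.
have phiN : phi (\sum_i 'X_i ^+ 2) =
    (\sum_i 'X_i ^+ 2)%:P + (c%:MP)%:P * 'X^2.
  rewrite rmorph_sum big_split_ord /=; congr (_ + _).
    rewrite rmorph_sum; apply: eq_bigr => i _.
    by rewrite !rmorphXn /= phiX /h (unsplitK (inl i)).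
  rewrite !rmorph_sum mulr_suml; apply: eq_bigr => j _.
  by rewrite rmorphXn /= phiX /h (unsplitK (inr j)) exprMn -rmorphXn /= !mxE sqr_sqrtr.
have phiv : map_mx phi (varmx R (n + m)) =
    col_mx (map_mx polyC (varmx R n)) ('X *: map_mx iota w).
  apply/colP => i; rewrite !mxE phiX /h.
  by case: split => j; rewrite !mxE // mulrC.
have phiM : map_mx phi (map_mx (@mpolyC (n + m) R) (block_mx M1 0 0 M2)) =
    block_mx (map_mx polyC (map_mx (@mpolyC n R) M1)) 0 0 (map_mx iota M2).
  have -> : map_mx phi (map_mx (@mpolyC (n + m) R) (block_mx M1 0 0 M2)) =
      map_mx iota (block_mx M1 0 0 M2) by apply/matrixP => i j; rewrite !mxE /= mmapC.
  by rewrite map_block_mx !map_mx0 map_mx_comp.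
apply: (@SOS_top_coef _ _ r _ (\sum_i 'X_i ^+ 2) _ [seq phi q | q <- s] c0).
have -> : \sum_(q <- [seq phi q | q <- s]) q ^+ 2 = phi (\sum_(q <- s) q ^+ 2).
  by rewrite big_map rmorph_sum; apply: eq_bigr => q _; rewrite rmorphXn.
rewrite -sE [RHS]rmorphM [in RHS]rmorphXn phiN; congr (_ * _).
rewrite [RHS]rmorph_qform map_sqmx phiM phiv sqmx_col qform_block.
(* The second block contributes t^4 times the image of [qform M2 z], which is zero. *)
rewrite sqmxZ qformZ -!map_sqmx sqw -[in X in _ * X]rmorph_qform Mz.
by rewrite rmorph0 mulr0 addr0 -rmorph_qform.
Qed.
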